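(* Let $(X,A)$ be a Hilbert bimodule, and let $I \lhd A$ be an ideal which is invariant with respect to $X$, i.e. $IX = XI$. Define $$X_I := \overline{\operatorname{span}}\{\xi a : \xi \in X,\ a \in I\} \subset X.$$ Then $(X_I, I)$ is a Hilbert bimodule, with left and right inner products and left and right actions inherited from $(X,A)$. Furthermore, $(X,A)$ is an extension of $(X_I,I)$ (via the inclusion maps $X_I \hookrightarrow X$ and $I \hookrightarrow A$), and this extension is essential if and only if $I$ is an essential ideal in $A$.
   Context: Ideals of $C^*$-algebras are closed and two-sided. For a $C^*$-algebra $A$, a right Hilbert $A$-module is a Banach space $X$ with a non-degenerate right action of $A$ and an $A$-valued inner product $\langle\cdot,\cdot\rangle_X$ with $\langle \xi,\eta a\rangle_X=\langle\xi,\eta\rangle_X a$, $\langle\eta,\xi\rangle_X=\langle\xi,\eta\rangle_X^*$, $\langle\xi,\xi\rangle_X\ge 0$ and $\|\xi\|=\|\langle\xi,\xi\rangle_X\|^{1/2}$. A left Hilbert $A$-module is a Banach space with a non-degenerate left action of $A$ and an $A$-valued inner product ${}_X\langle\cdot,\cdot\rangle$ with ${}_X\langle a\xi,\eta\rangle=a\,{}_X\langle\xi,\eta\rangle$, ${}_X\langle\eta,\xi\rangle={}_X\langle\xi,\eta\rangle^*$, ${}_X\langle\xi,\xi\rangle\ge0$ and $\|\xi\|=\|{}_X\langle\xi,\xi\rangle\|^{1/2}$. The pair $(X,A)$ is a Hilbert bimodule if $X$ is simultaneously a left and a right Hilbert $A$-module and ${}_X\langle\xi,\eta\rangle\zeta=\xi\langle\eta,\zeta\rangle_X$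 for all $\xi,\eta,\zeta\in X$. A morphism $(X,A)\to(Y,B)$ of Hilbert bimodules is a pair $(\psi_X,\psi_A)$ with $\psi_X:X\to Y$ linear and $\psi_A:A\to B$ a $*$-homomorphism such that $\psi_X(\xi a)=\psi_X(\xi)\psi_A(a)$, $\psi_X(a\xi)=\psi_A(a)\psi_X(\xi)$, $\psi_A(\langle\xi,\eta\rangle_X)=\langle\psi_X(\xi),\psi_X(\eta)\rangle_Y$ and $\psi_A({}_X\langle\xi,\eta\rangle)={}_Y\langle\psi_X(\xi),\psi_X(\eta)\rangle$. An ideal $I$ of $A$ is invariant with respect to $X$ if $IX=XI$. A Hilbert bimodule $(Y,B)$ is an extension of $(X,A)$ if $B$ is a $C^*$-algebra containing $A$ as an ideal, there is a morphism of Hilbert bimodules $(\psi_X,\psi_A):(X,A)\to(Y,B)$ such that $\psi_A$ is the inclusion of $A$ in $B$, and $A$ is invariant with respect to $Y$. The extension is essential if $A$ is an essential ideal in $B$. *)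

(* Defs.v *)
From HB Require Import structures.
From mathcomp Require Import all_boot all_order all_algebra.
From mathcomp Require Import all_classical all_reals all_analysis.
From mathcomp.real_closed Require Import complex.

Set Implicit Arguments.
Unset Strict Implicit.
Unset Printing Implicit Defensive.

Import Order.TTheory GRing.Theory Num.Theory.
Import numFieldNormedType.Exports.

Local Open Scope classical_set_scope.
Local Open Scope ring_scope.

Definition lin_span (K : numFieldType) (V : lmodType K) (S : set V) : set V :=
  [set v | exists (n : nat) (c : 'I_n -> K) (s : 'I_n -> V),
     (forall i, S (s i)) /\ v = \sum_(i < n) c i *: s i].

Definition closed_span (K : numFieldType) (V : normedModType K) (S : set V) :
  set V := closure (lin_span S).

(* The product is a field of the structure because MathComp rings are unital,
   whereas C*-algebras are not assumed to be. *)
HB.mixin Record isCStarAlgebra (R : realType) A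
    of CompleteNormedModule R[i] A := {
  cmul : A -> A -> A;
  star : A -> A;
  cmulA : associative cmul;
  cmul_linearl : forall b : A, linear (fun a : A => cmul a b);
  cmul_linearr : forall a : A, linear (fun b : A => cmul a b);
  star_conj_linear : forall (l : R[i]) (a b : A),
    star (l *: a + b) = Num.conj l *: star a + star b;
  starK : involutive star;
  star_cmul : forall a b : A, star (cmul a b) = cmul (star b) (star a);
  norm_cmul : forall a b : A, `|cmul a b| <= `|a| * `|b|;
  cstar_identity : forall a : A, `|cmul (star a) a| = `|a| ^+ 2
}.

#[short(type="cstarAlgType")]
HB.structure Definition CStarAlgebra (R : realType) :=
  {A of isCStarAlgebra R A & CompleteNormedModule R[i] A}.

(* The product of the unitization A (+) C, whose unit is (0, 1). *)
Definition unitization_mul (R : realType) (A : cstarAlgType R)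
    (x y : A * R[i]) : A * R[i] :=
  (cmul x.1 y.1 + y.2 *: x.1 + x.2 *: y.1, x.2 * y.2).

(* The spectrum in the unitization. If A already has a unit this only adds the
   point 0, which does not affect positivity. *)
Definition spectrum (R : realType) (A : cstarAlgType R) (a : A) : set R[i] :=
  [set l | ~ exists y : A * R[i],
     unitization_mul (a, - l) y = (0, 1) /\
     unitization_mul y (a, - l) = (0, 1)].

(* In R[i], 0 <= l means that l is real and nonnegative. *)
Definition positive (R : realType) (A : cstarAlgType R) (a : A) : Prop :=
  star a = a /\ spectrum a `<=` [set l | 0 <= l].

HB.mixin Record isRightHilbertModule (R : realType) (A : cstarAlgType R) X
    of CompleteNormedModule R[i] X := {
  ract : X -> A -> X;
  rinner : X -> X -> A;
  ract_linearl : forall a : A, linear (fun x : X => ract x a);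
  ract_linearr : forall x : X, linear (fun a : A => ract x a);
  ractA : forall (x : X) (a b : A), ract (ract x a) b = ract x (cmul a b);
  ract_nondegenerate :
    closed_span [set ract x a | x in [set: X] & a in [set: A]] = [set: X];
  rinner_linear : forall x : X, linear (fun y : X => rinner x y);
  rinner_ract : forall (x y : X) (a : A),
    rinner x (ract y a) = cmul (rinner x y) a;
  rinner_star : forall x y : X, rinner y x = star (rinner x y);
  rinner_ge0 : forall x : X, positive (rinner x x);
  norm_rinner : forall x : X, `|x| = sqrtC `|rinner x x|
}.

#[short(type="rightHilbertModType")]
HB.structure Definition RightHilbertModule (R : realType) (A : cstarAlgType R) :=
  {X of isRightHilbertModule R A X & CompleteNormedModule R[i] X}.

HB.mixin Record isLeftHilbertModule (R : realType) (A : cstarAlgType R) X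
    of CompleteNormedModule R[i] X := {
  lact : A -> X -> X;
  linner : X -> X -> A;
  lact_linearl : forall x : X, linear (fun a : A => lact a x);
  lact_linearr : forall a : A, linear (fun x : X => lact a x);
  lactA : forall (a b : A) (x : X), lact a (lact b x) = lact (cmul a b) x;
  lact_nondegenerate :
    closed_span [set lact a x | a in [set: A] & x in [set: X]] = [set: X];
  linner_linear : forall y : X, linear (fun x : X => linner x y);
  linner_lact : forall (a : A) (x y : X),
    linner (lact a x) y = cmul a (linner x y);
  linner_star : forall x y : X, linner y x = star (linner x y);
  linner_ge0 : forall x : X, positive (linner x x);
  norm_linner : forall x : X, `|x| = sqrtC `|linner x x|
}.

#[short(type="leftHilbertModType")]
HB.structure Definition LeftHilbertModule (R : realType) (A : cstarAlgType R) :=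
  {X of isLeftHilbertModule R A X & CompleteNormedModule R[i] X}.

HB.mixin Record Left_Right_isHilbertBimodule
    (R : realType) (A : cstarAlgType R) X
    of LeftHilbertModule R A X & RightHilbertModule R A X := {
  inner_compat : forall x y z : X,
    lact (linner x y : A) z = ract x (rinner y z : A)
}.

#[short(type="hilbertBimodType")]
HB.structure Definition HilbertBimodule (R : realType) (A : cstarAlgType R) :=
  {X of Left_Right_isHilbertBimodule R A X
      & LeftHilbertModule R A X & RightHilbertModule R A X}.

Definition is_star_hom (R : realType) (A B : cstarAlgType R) (psiA : A -> B) :
    Prop :=
  [/\ linear psiA,
      forall a b, psiA (cmul a b) = cmul (psiA a) (psiA b)
    & forall a, psiA (star a) = star (psiA a)].

Definition is_bimod_morphism (R : realType)
    (A : cstarAlgType R) (X : hilbertBimodType A)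
    (B : cstarAlgType R) (Y : hilbertBimodType B)
    (psiX : X -> Y) (psiA : A -> B) : Prop :=
  [/\ linear psiX /\ is_star_hom psiA,
      forall (x : X) (a : A), psiX (ract x a) = ract (psiX x) (psiA a),
      forall (a : A) (x : X), psiX (lact a x) = lact (psiA a) (psiX x),
      forall x y : X, psiA (rinner x y) = rinner (psiX x) (psiX y)
    & forall x y : X, psiA (linner x y) = linner (psiX x) (psiX y)].

Definition is_ideal (R : realType) (A : cstarAlgType R) (I : set A) : Prop :=
  [/\ closed I, I 0,
      forall (l : R[i]) (a b : A), I a -> I b -> I (l *: a + b)
    & forall a b : A, I b -> I (cmul a b) /\ I (cmul b a)].

Definition is_essential (R : realType) (A : cstarAlgType R) (I : set A) : Prop :=
  is_ideal I /\
  forall J : set A, is_ideal J -> J <> [set 0] -> I `&` J <> [set 0].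

(* Products of ideals and modules are closed linear spans of products. *)
Definition ideal_lmul (R : realType) (A : cstarAlgType R)
    (I : set A) (X : hilbertBimodType A) : set X :=
  closed_span [set lact a x | a in I & x in [set: X]].
Arguments ideal_lmul {R A} I X.

Definition ideal_rmul (R : realType) (A : cstarAlgType R)
    (X : hilbertBimodType A) (I : set A) : set X :=
  closed_span [set ract x a | x in [set: X] & a in I].
Arguments ideal_rmul {R A} X I.

Definition is_invariant (R : realType) (A : cstarAlgType R)
    (X : hilbertBimodType A) (I : set A) : Prop :=
  ideal_lmul I X = ideal_rmul X I.

(* (Y, B) is an extension of (X, A) via (psiX, psiA), where A is identified
   with its image in B under psiA. *)
Definition is_extension (R : realType)
    (A : cstarAlgType R) (X : hilbertBimodType A)
    (B : cstarAlgType R) (Y : hilbertBimodType B)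
    (psiX : X -> Y) (psiA : A -> B) : Prop :=
  [/\ is_bimod_morphism psiX psiA,
      injective psiA,
      is_ideal (range psiA)
    & is_invariant Y (range psiA)].

Definition is_essential_extension (R : realType)
    (A : cstarAlgType R) (X : hilbertBimodType A)
    (B : cstarAlgType R) (Y : hilbertBimodType B)
    (psiX : X -> Y) (psiA : A -> B) : Prop :=
  is_extension psiX psiA /\ is_essential (range psiA).

(* [cstar_on R T] is the type of C*-algebra structures on the bare type T, and
   [hilbert_bimod_on A T] that of Hilbert A-bimodule structures on T. *)
Definition cstar_on (R : realType) (T : Type) : Type :=
  CStarAlgebra.axioms_ R T.

Definition cstar_of (R : realType) (T : Type) (s : cstar_on R T) :
  cstarAlgType R := CStarAlgebra.Pack s.

Definition hilbert_bimod_on (R : realType) (A : cstarAlgType R) (T : Type) :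
  Type := HilbertBimodule.axioms_ A T.

Definition hilbert_bimod_of (R : realType) (A : cstarAlgType R) (T : Type)
  (s : hilbert_bimod_on A T) : hilbertBimodType A := HilbertBimodule.Pack s.

(* Main.v *)
Require Import Defs.
From HB Require Import structures.
From mathcomp Require Import all_boot all_order all_algebra.
From mathcomp Require Import all_classical all_reals all_analysis.
From mathcomp.real_closed Require Import complex.
From mathcomp Require Import ring.

Set Implicit Arguments.
Unset Strict Implicit.
Unset Printing Implicit Defensive.

Import Order.TTheory GRing.Theory Num.Theory.
Import numFieldNormedType.Exports.

Local Open Scope classical_set_scope.
Local Open Scope ring_scope.

(** The C*-algebraic input is that a closed two-sided ideal [I] of [A] has
    approximate units in the following weak form: if [b^* b] lies in [I], then
    [b] is a limit of products [b c] with [c] in [I] ([ideal_approx_unit]).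
    With [b := a^*] this shows that [I] is selfadjoint, so that it is a
    C*-algebra; with [b := a] it shows that [I I] is dense in [I], which makes
    the actions of [I] on [X_I] non-degenerate: a generator [x a] of [X_I] is
    approximated by [(x a) c].

    No functional calculus is needed for this. Let [h := b^* b], let [s > 0]
    and write [1 - c = i s (h + i s)^-1], so that [h - h c = i s c]; the
    unitization is avoided by solving this last equation for [c] in [A].
    Selfadjointness of [h] makes the Cayley transform
    [1 - 2 c = -(h - i s) (h + i s)^-1] unitary, that is
    [2 c^* c = c + c^*] ([cayley_unitary]), and hence [|c| <= 1]. Then
    [(b - b c)^* (b - b c) = (1 - c^* ) (h - h c) = i s (c - c^* c)
     = i s (c - c^* ) / 2] has norm at most [s]. The element
    [c = (h - h c) / (i s)] lies in every ideal that contains [h].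
    A solution [c] exists for [s > |h|] because [c |-> (h - h c) / (i s)] is a
    contraction; as left multiplication by [1 - c] does not increase norms, a
    second fixed point argument goes down from there to every smaller [s > 0]
    ([resolvent_exists]).

    The rest is a verification of what is inherited. Inner products of elements
    of [X_I = X I = I X] lie in [I], since they do so on generators, and the
    inner products are continuous by polarization ([inner_bounded]). Positivity
    passes from [A] to [I] because, for [l <> 0], an inverse [(y1, y2)] of
    [(a, - l)] satisfies [y1 = (a y1 + y2 a) / l], so that [y1] is in [I]
    ([positive_ideal]). Finally, the image of the inclusion of [I] is [I]
    itself, and the equivalence about essential extensions is immediate. *)

(** * Linear maps, closures and contractions *)

Section Linear.
Context {K : numFieldType} {U V : lmodType K} {f : U -> V}.
Hypothesis f_lin : linear f.

Lemma lin0 : f 0 = 0.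
Proof.
have := f_lin (-1) 0 0; rewrite !scaler0 addr0 => {1}->.
by rewrite scaleN1r addNr.
Qed.

Lemma linD x y : f (x + y) = f x + f y.
Proof. by rewrite -{1}(scale1r x) f_lin scale1r. Qed.

Lemma linZ l x : f (l *: x) = l *: f x.
Proof. by rewrite -{1}(addr0 (l *: x)) f_lin lin0 addr0. Qed.

Lemma linN x : f (- x) = - f x.
Proof. by rewrite -scaleN1r linZ scaleN1r. Qed.

Lemma linB x y : f (x - y) = f x - f y.
Proof. by rewrite linD linN. Qed.

Lemma lin_sum n (c : 'I_n -> K) (s : 'I_n -> U) :
  f (\sum_(i < n) c i *: s i) = \sum_(i < n) c i *: f (s i).
Proof.
rewrite (big_morph f linD lin0).
by apply: eq_bigr => i _; rewrite linZ.
Qed.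

End Linear.

Section Approximation.
Context {R : realType}.

Lemma gt0_realC (e : R[i]) : 0 < e -> exists2 r : R, 0 < r & e = r%:C%C.
Proof.
move=> e0; have /complex_realP[r er] : e \is Num.real by exact: gtr0_real.
by exists r => //; move: e0; rewrite er ltcR.
Qed.

Lemma closureP_norm (V : normedModType R[i]) (S : set V) (x : V) :
  closure S x <-> forall e : R[i], 0 < e -> exists2 y, S y & `|x - y| < e.
Proof.
split=> [cx e e0|H B /nbhs_ballP[e /= e0 eB]].
  have [y [Sy]] := cx _ (nbhsx_ballx x e e0).
  by rewrite -ball_normE /= => xy; exists y.
have [y Sy xy] := H e e0; exists y; split => //.
by apply: eB; rewrite -ball_normE.
Qed.

(** The scalars form only a partially ordered field, which is why the usual
    statements about geometric sequences do not apply to them directly. *)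
Lemma expr_lt_eventually (q C e : R[i]) : 0 <= q < 1 -> 0 <= C -> 0 < e ->
  exists N, forall n, (N <= n)%N -> C * q ^+ n < e.
Proof.
move=> /andP[q0 q1] C0 /gt0_realC[r r0 ->].
have /complex_realP[c cE] : C \is Num.real by exact: ger0_real.
have /complex_realP[p pE] : q \is Num.real by exact: ger0_real.
rewrite cE pE in C0 q0 q1 *; rewrite lecR in C0; rewrite lecR in q0.
rewrite ltcR in q1.
have := @cvg_geometric R c p; rewrite ger0_norm// => /(_ q1).
move=> /cvgrPdist_lt/(_ _ r0)[N _ HN]; exists N => n Nn.
have := HN n Nn; rewrite sub0r normrN /geometric /= ger0_norm; last first.
  by rewrite mulr_ge0// exprn_ge0.
by rewrite -rmorphXn -rmorphM ltcR.
Qed.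

(** The Banach fixed point theorem over the complex numbers, for a map defined
    on the whole space. *)
Lemma contraction_fixpoint (V : completeNormedModType R[i]) (q : R[i])
    (f : V -> V) :
  0 <= q < 1 -> (forall x y, `|f x - f y| <= q * `|x - y|) ->
  exists p, f p = p.
Proof.
move=> q01 fq; have /andP[q0 q1] := q01.
pose y n := iter n f 0.
pose C := `|f 0| / (1 - q).
have Q1 : 0 < 1 - q :> R[i] by rewrite subr_gt0.
have C0 : 0 <= C by rewrite divr_ge0// ltW.
(* [C] is the fixed point of [t |-> q t + |f 0|], so it bounds all iterates. *)
have yC m : `|y m| <= C.
  elim: m => [|m IH]; first by rewrite normr0.
  have -> : C = q * C + `|f 0|.
    by have <- : C * (1 - q) = `|f 0|; [rewrite divfK ?lt0r_neq0|ring].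
  rewrite /y iterS -/(y m) -(subrK (f 0) (f (y m))).
  rewrite (le_trans (ler_normD _ _))// lerD2r (le_trans (fq _ _))//.
  by rewrite subr0 ler_wpM2l.
have yq n m : `|y n - y (n + m)%N| <= C * q ^+ n.
  elim: n => [|n IH]; first by rewrite sub0r normrN expr0 mulr1.
  rewrite addSn /y !iterS (le_trans (fq _ _))// exprS mulrCA.
  by rewrite ler_wpM2l.
have cy : cvgn y.
  apply/cauchy_cvgP/cauchy_ballP => e e0; near_simpl.
  have [N HN] := expr_lt_eventually q01 C0 (divr_gt0 e0 (ltr0n _ 2)).
  exists ([set n | (N <= n)%N], [set n | (N <= n)%N]); first by split; exists N.
  move=> [n m] [/= Nn Nm]; rewrite -ball_normE /=.
  rewrite (splitr e); apply: (le_lt_trans (ler_distD (y N) _ _)); apply: ltrD.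
    rewrite -(subnKC Nn) distrC; apply: le_lt_trans (yq _ _) (HN _ _) => //.
  rewrite -(subnKC Nm); apply: le_lt_trans (yq _ _) (HN _ _) => //.
exists (limn y); apply/eqP; rewrite eq_sym -subr_eq0 -normr_eq0.
apply/negPn/negP => nz; set p := limn y in nz *.
have e0 : 0 < `|p - f p| / 2 by rewrite divr_gt0// lt0r nz/=.
have /cvgrPdist_lt/(_ _ e0)[N _ HN] : y @ \oo --> p by [].
suff : `|p - f p| < `|p - f p| by rewrite ltxx.
rewrite {2}(splitr `|_|); apply: (le_lt_trans (ler_distD (y N.+1) _ _)).
apply: ltrD; first exact: HN (leqnSn N).
rewrite /y iterS; apply: le_lt_trans (fq _ _) _.
rewrite distrC; apply: le_lt_trans (HN N (leqnn _)).
by rewrite -[leRHS]mul1r ler_wpM2r// ltW.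
Qed.

End Approximation.

(** * The resolvent of a selfadjoint element on the imaginary axis *)

Section CStarBasics.
Context {R : realType} {A : cstarAlgType R}.
Implicit Types (a b c h x y : A) (s t l : R[i]).

Lemma cmulDl a b c : cmul (a + b) c = cmul a c + cmul b c.
Proof. exact: (linD (cmul_linearl c)). Qed.
Lemma cmulDr c a b : cmul c (a + b) = cmul c a + cmul c b.
Proof. exact: (linD (cmul_linearr c)). Qed.
Lemma cmulBl a b c : cmul (a - b) c = cmul a c - cmul b c.
Proof. exact: (linB (cmul_linearl c)). Qed.
Lemma cmulBr c a b : cmul c (a - b) = cmul c a - cmul c b.
Proof. exact: (linB (cmul_linearr c)). Qed.
Lemma cmulZl l a c : cmul (l *: a) c = l *: cmul a c.
Proof. exact: (linZ (cmul_linearl c)). Qed.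
Lemma cmulZr l c a : cmul c (l *: a) = l *: cmul c a.
Proof. exact: (linZ (cmul_linearr c)). Qed.

Lemma starD a b : star (a + b) = star a + star b.
Proof. by have := star_conj_linear 1 a b; rewrite rmorph1 !scale1r. Qed.

Lemma star0 : star 0 = 0 :> A.
Proof. by apply: (addrI (star (0 : A))); rewrite -starD !addr0. Qed.

Lemma starZ l a : star (l *: a) = Num.conj l *: star a.
Proof. by rewrite -[l *: a]addr0 star_conj_linear star0 addr0. Qed.

Lemma starN a : star (- a) = - star a.
Proof. by rewrite -scaleN1r starZ rmorphN rmorph1 scaleN1r. Qed.

Lemma starB a b : star (a - b) = star a - star b.
Proof. by rewrite starD starN. Qed.

Lemma norm_star a : `|star a| = `|a|.
Proof.
suff H b : `|b| <= `|star b|.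
  by apply/le_anti; rewrite H andbT -[in leRHS](starK a) H.
have [->|b0] := eqVneq b 0; first by rewrite normr0.
have nb : 0 < `|b| by rewrite normr_gt0.
by rewrite -(ler_pM2r nb) -expr2 -cstar_identity norm_cmul.
Qed.

(** With [h] selfadjoint and [s > 0], the equation [h - h c = i s c] says that
    [1 - c] is [i s (h + i s)^-1] in the unitization. Its consequence
    [2 c^* c = c + c^*] says that the Cayley transform [1 - 2 c] is an
    isometry. *)
Lemma cayley_unitary h c s : star h = h -> 0 < s ->
  h - cmul h c = (s * 'i) *: c ->
  cmul (star c) c + cmul (star c) c = c + star c.
Proof.
move=> hh s0 E.
have sN0 : s * 'i != 0 :> R[i] by rewrite mulf_neq0 ?neq0Ci// gt_eqF.
(* Multiply the equation by [c^*] on the left, its adjoint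
   [h - c^* h = - i s c^*] by [c] on the right, and subtract. *)
have E1 : cmul (star c) h - cmul (star c) (cmul h c)
    = (s * 'i) *: cmul (star c) c.
  by rewrite -cmulBr E cmulZr.
have E2 : h - cmul (star c) h = - ((s * 'i) *: star c).
  have := congr1 star E; rewrite starB star_cmul hh starZ => ->.
  by rewrite rmorphM /= conjCi conj_Creal ?gtr0_real// mulrN scaleNr.
have E3 : cmul h c - cmul (star c) (cmul h c) = - ((s * 'i) *: cmul (star c) c).
  by rewrite -cmulZl -(linN (cmul_linearl c)) -E2 cmulBl cmulA.
apply: (scalerI sN0); rewrite !scalerDr -E -[X in _ + X]opprK -E3 -E1.
rewrite opprB addrA subrK -[(s * 'i) *: star c]opprK -E2 opprB.
by rewrite [RHS]addrC addrA subrK.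
Qed.

(** Left multiplication by [1 - 2 c] is isometric, where
    [(1 - 2 c)^* (1 - 2 c) = 1]. *)
Lemma cayley_norm c x : cmul (star c) c + cmul (star c) c = c + star c ->
  `|x - (cmul c x + cmul c x)| = `|x|.
Proof.
move=> E; apply/eqP; rewrite -(eqrXn2 (n := 2))// -!cstar_identity; apply/eqP.
congr `|_|; rewrite -cmulDl starB star_cmul starD cmulBl !cmulBr.
rewrite -!cmulA [cmul (star c + _) (cmul _ x)]cmulA.
have -> : cmul (star c + star c) (c + c) = c + star c + (c + star c).
  by rewrite cmulDl cmulDr E.
by rewrite -!cmulBr addrACA [cmul (c + c + _) x]cmulDl opprB addrK subrK.
Qed.

(** Because [1 - c] is the mean of [1] and [1 - 2 c]. *)
Lemma norm_sub_cmul_le c x : cmul (star c) c + cmul (star c) c = c + star c ->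
  `|x - cmul c x| <= `|x|.
Proof.
move=> E; rewrite -(ler_pM2l (ltr0n R[i] 2)).
rewrite !mulr_natl -normrMn [in leLHS]mulr2n.
have -> : x - cmul c x + (x - cmul c x) = x + (x - (cmul c x + cmul c x)).
  by rewrite addrACA opprD -addrA.
by rewrite (le_trans (ler_normD _ _))// (cayley_norm x E) mulr2n.
Qed.

Lemma cayley_norm_le1 c : cmul (star c) c + cmul (star c) c = c + star c ->
  `|c| <= 1.
Proof.
move=> E; have [->|c0] := eqVneq c 0; first by rewrite normr0.
have nc : 0 < `|c| by rewrite normr_gt0.
rewrite -(ler_pM2r nc) mul1r -expr2 -cstar_identity.
rewrite -(ler_pM2l (ltr0n R[i] 2)) !mulr_natl -normrMn mulr2n E.
by rewrite (le_trans (ler_normD _ _))// norm_star mulr2n.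
Qed.

Lemma resolvent_exists_large h t : `|h| < t ->
  exists c, h - cmul h c = (t * 'i) *: c.
Proof.
move=> ht; have t0 : 0 < t by apply: le_lt_trans ht.
have tN0 : t * 'i != 0 :> R[i] by rewrite mulf_neq0 ?neq0Ci// gt_eqF.
have [||c cE] := @contraction_fixpoint _ A (`|h| / t)
    (fun c => (t * 'i)^-1 *: (h - cmul h c)).
- by rewrite divr_ge0 ?(ltW t0)//= ltr_pdivrMr// mul1r.
- move=> x y; rewrite -scalerBr opprB addrC addrA subrK -cmulBr normrZ.
  rewrite normfV normrM normCi mulr1 (gtr0_norm t0) [`|h| / t]mulrC -mulrA.
  by rewrite ler_wpM2l ?invr_ge0 ?(ltW t0)// distrC norm_cmul.
by exists c; rewrite -{2}cE scalerA mulfV// scale1r.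
Qed.

(** With [d] the solution at the height [t := |h| + s], a solution at the
    height [s] is a fixed point of the map [c |-> d + (1 - s / t) (1 - d) c],
    which is a contraction since [1 - d] does not increase norms. *)
Lemma resolvent_exists h s : star h = h -> 0 < s ->
  exists c, h - cmul h c = (s * 'i) *: c.
Proof.
move=> hh s0; pose t := `|h| + s.
have t0 : 0 < t by apply: ltr_wpDl.
have ht : `|h| < t by rewrite ltrDl.
have [d dE] := resolvent_exists_large ht.
have dd := cayley_unitary hh t0 dE.
pose k := `|h| / t.
have [||c cE] := @contraction_fixpoint _ A k
    (fun c => d + k *: (c - cmul d c)).
- by rewrite divr_ge0 ?(ltW t0)//= ltr_pdivrMr// mul1r ltrDl.
- move=> x y; rewrite opprD addrACA subrr add0r -scalerBr normrZ.
  have -> : x - cmul d x - (y - cmul d y) = x - y - cmul d (x - y).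
    by rewrite cmulBr opprD addrACA -opprD.
  rewrite ger0_norm ?divr_ge0 ?(ltW t0)//.
  by rewrite ler_wpM2l ?divr_ge0 ?(ltW t0)//; exact: norm_sub_cmul_le.
exists c.
have hd : cmul h d = h - (t * 'i) *: d by rewrite -dE opprB addrC subrK.
have kt : k * (t * 'i) = (t - s) * 'i.
  by rewrite /t addrK mulrA divfK// gt_eqF.
have -> : cmul h c = h - (t * 'i) *: d + ((t - s) * 'i) *: cmul d c.
  rewrite -{1}cE cmulDr cmulZr cmulBr cmulA hd cmulBl cmulZl.
  by rewrite subKr scalerA kt.
have -> : (s * 'i) *: c = (t * 'i) *: c - ((t - s) * 'i) *: c.
  by rewrite -scalerBl -mulrBl opprB addrC subrK.
have -> : (t * 'i) *: c
    = (t * 'i) *: d + ((t - s) * 'i) *: c - ((t - s) * 'i) *: cmul d c.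
  by rewrite -{1}cE scalerDr scalerA [_ * k]mulrC kt scalerBr addrA.
by rewrite opprD addrA subKr [RHS]addrAC !addrK.
Qed.

(** Any element [b] is a limit of products [b c], where [c] solves the resolvent
    equation of [b^* b]. The bound obtained is [|b - b c| ^ 2 <= s]. *)
Lemma approx_unit b e : 0 < e -> exists c,
  (exists2 s,
     0 < s & cmul (star b) b - cmul (cmul (star b) b) c = (s * 'i) *: c) /\
  `|b - cmul b c| < e.
Proof.
move=> e0; pose s := (e / 2) ^+ 2; have s0 : 0 < s.
  by rewrite exprn_gt0// divr_gt0.
have hh : star (cmul (star b) b) = cmul (star b) b by rewrite star_cmul starK.
have [c E] := resolvent_exists hh s0; have cc := cayley_unitary hh s0 E.
exists c; split; first by exists s.
suff H : `|b - cmul b c| ^+ 2 <= s.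
  have e2 : 0 <= e / 2 by rewrite divr_ge0// ltW.
  have : `|b - cmul b c| <= e / 2.
    by rewrite -(@ler_pXn2r _ 2) ?nnegrE ?normr_ge0.
  by move/le_lt_trans; apply; rewrite ltr_pdivrMr// ltr_pMr// ltr1n.
rewrite -cstar_identity starB star_cmul cmulBl !cmulBr -!cmulA.
rewrite [cmul (star b) (cmul b c)]cmulA -cmulBr E cmulZr -scalerBr normrZ.
rewrite normrM normCi mulr1 gtr0_norm// -[leRHS]mulr1 ler_pM2l//.
rewrite -(ler_pM2l (ltr0n R[i] 2)) !mulr_natl -normrMn mulr2n addrACA -opprD cc.
rewrite opprD addrA addrK (le_trans (ler_normB _ _))// norm_star mulr2n.
by rewrite lerD ?cayley_norm_le1.
Qed.

End CStarBasics.

(** * Closed spans *)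

Section ClosedSpan.
Context {R : realType}.

(** [N] is a closed linear subspace of [V]. *)
Definition closed_submod (V : normedModType R[i]) (N : set V) : Prop :=
  [/\ closed N, N 0 & forall (l : R[i]) a b, N a -> N b -> N (l *: a + b)].

Lemma closed_approx (V : normedModType R[i]) (N : set V) (x : V) : closed N ->
  (forall e : R[i], 0 < e -> exists2 y, N y & `|x - y| < e) -> N x.
Proof. by move=> cN H; apply/cN/closureP_norm. Qed.

Lemma closed_submod_sum (V : normedModType R[i]) (N : set V) n
    (c : 'I_n -> R[i]) (s : 'I_n -> V) : closed_submod N ->
  (forall i, N (s i)) -> N (\sum_(i < n) c i *: s i).
Proof.
by case=> _ N0 Nl Ns; apply: (big_rec N) => // i x _ Nx; exact: Nl.
Qed.

Lemma lin_span_comb (V : normedModType R[i]) (S : set V) (l : R[i]) x y :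
  lin_span S x -> lin_span S y -> lin_span S (l *: x + y).
Proof.
move=> [n [c [s [Ss ->]]]] [m [d [t [St ->]]]].
(* [f] concatenates two finite families. *)
pose f (T : Type) (u : 'I_n -> T) (v : 'I_m -> T) (i : 'I_(n + m)) :=
  match fintype.split i with inl j => u j | inr j => v j end.
exists (n + m)%N, (f _ (fun i => l * c i) d), (f _ s t); split.
  by move=> i; rewrite /f; case: splitP.
rewrite big_split_ord /= scaler_sumr; congr (_ + _); apply: eq_bigr => i _.
  by rewrite /f -[lshift _ _]/(unsplit (inl i)) unsplitK scalerA.
by rewrite /f -[rshift _ _]/(unsplit (inr i)) unsplitK.
Qed.

Lemma closed_span_submod (V : normedModType R[i]) (S : set V) :
  closed_submod (closed_span S).
Proof.
split; first exact: closed_closure.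
  apply: subset_closure; exists 0%N, (fun=> 0), (fun=> 0).
  by split; [case|rewrite big_ord0].
move=> l x y /closureP_norm cx /closureP_norm cy; apply/closureP_norm => e e0.
have l0 : 0 < `|l| + 1 by rewrite ltr_wpDl.
have e2 : 0 < e / 2 by rewrite divr_gt0.
have [x' Sx xx] := cx _ (divr_gt0 e2 l0).
have [y' Sy yy] := cy _ e2.
exists (l *: x' + y'); first exact: lin_span_comb.
rewrite opprD addrACA -scalerBr (le_lt_trans (ler_normD _ _))// (splitr e).
apply: ler_ltD yy; rewrite normrZ; rewrite ltr_pdivlMr// in xx.
apply: le_trans (ltW xx); rewrite mulrC ler_wpM2l// lerDl//.
Qed.

Lemma sub_closed_span (V : normedModType R[i]) (S : set V) :
  S `<=` closed_span S.
Proof.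
move=> x Sx; apply: subset_closure; exists 1%N, (fun=> 1), (fun=> x).
by split=> //; rewrite big_ord1 scale1r.
Qed.

Lemma closed_span_image (V W : normedModType R[i]) (f : V -> W) (S : set V)
    (N : set W) :
  linear f -> (exists2 C, 0 <= C & forall v, `|f v| <= C * `|v|) ->
  closed_submod N -> (forall v, S v -> N (f v)) ->
  forall v, closed_span S v -> N (f v).
Proof.
move=> fl [C C0 fC] NN Sf v /closureP_norm Sv; have [cN _ _] := NN.
apply: closed_approx => // e e0.
have C1 : 0 < C + 1 by rewrite ltr_wpDl.
have [_ [n [c [s [Ss ->]]]] vw] := Sv _ (divr_gt0 e0 C1).
exists (f (\sum_(i < n) c i *: s i)).
  by rewrite (lin_sum fl); apply: closed_submod_sum => // i; exact: Sf.
rewrite -(linB fl); set w := v - _ in vw *.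
rewrite ltr_pdivlMr// in vw; apply: le_lt_trans vw.
by apply: le_trans (fC w) _; rewrite mulrC ler_wpM2l// lerDl.
Qed.

Lemma closed_span_min (V : normedModType R[i]) (S N : set V) :
  closed_submod N -> S `<=` N -> closed_span S `<=` N.
Proof.
move=> NN SN v; apply: (@closed_span_image V V id) => //.
by exists 1 => [|w]; [exact: ler01|rewrite mul1r].
Qed.

End ClosedSpan.

(** * Approximate units in ideals *)

Lemma ideal_closed_submod (R : realType) (A : cstarAlgType R) (I : set A) :
  is_ideal I -> closed_submod I.
Proof. by case. Qed.

Section Ideal.
Context {R : realType} {A : cstarAlgType R} {I : set A}.
Hypothesis I_ideal : is_ideal I.

Lemma ideal_approx_unit (b : A) (e : R[i]) : 0 < e -> I (cmul (star b) b) ->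
  exists2 c, I c & `|b - cmul b c| < e.
Proof.
move=> e0 Ih; have [c [[s s0 E] ce]] := approx_unit b e0; exists c => //.
have [_ I0 Il Im] := I_ideal.
have sN0 : s * 'i != 0 :> R[i] by rewrite mulf_neq0 ?neq0Ci// gt_eqF.
rewrite -[c]scale1r -(mulVf sN0) -scalerA -E -[_ *: _]addr0.
apply: (Il) => //; rewrite addrC -scaleN1r; apply: Il => //.
by have [] := Im c _ Ih.
Qed.

(** Closed two-sided ideals are selfadjoint: approximate [a^*] by [a^* c]. *)
Lemma ideal_star (a : A) : I a -> I (star a).
Proof.
move=> Ia; have [cI _ _ Im] := I_ideal; apply: closed_approx => // e e0.
have [|c Ic ac] := @ideal_approx_unit (star a) e e0.
  by rewrite starK; have [] := Im (star a) _ Ia.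
by exists (cmul (star a) c) => //; have [] := Im (star a) _ Ic.
Qed.

Lemma ideal_right_unit (a : A) (e : R[i]) : I a -> 0 < e ->
  exists2 c, I c & `|a - cmul a c| < e.
Proof.
move=> Ia e0; apply: ideal_approx_unit => //.
by have [_ _ _ Im] := I_ideal; have [] := Im (star a) _ Ia.
Qed.

Lemma ideal_left_unit (a : A) (e : R[i]) : I a -> 0 < e ->
  exists2 c, I c & `|a - cmul c a| < e.
Proof.
move=> Ia e0; have [c Ic ac] := ideal_right_unit (ideal_star Ia) e0.
exists (star c); first exact: ideal_star.
by rewrite -norm_star starB star_cmul starK.
Qed.

End Ideal.

(** * Inner products and actions on a Hilbert bimodule *)

(** An [A]-valued sesquilinear form [B] whose diagonal gives the norm is
    continuous in its second variable. This follows from polarization: both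
    [B x y + B y x] and its analogue for [i y] are bounded by the norms of
    diagonal values. The Cauchy-Schwarz inequality is not needed. *)
Lemma inner_bounded (R : realType) (A : cstarAlgType R)
    (X : normedModType R[i]) (B : X -> X -> A) :
  (forall x, linear (B x)) -> (forall x y, B y x = star (B x y)) ->
  (forall x, `|x| = sqrtC `|B x x|) ->
  forall x, exists2 C, 0 <= C & forall y, `|B x y| <= C * `|y|.
Proof.
move=> Bl Bs Bn x.
have n2 y : `|B y y| = `|y| ^+ 2 by rewrite Bn sqrtCK.
have BDl y z w : B (y + z) w = B y w + B z w.
  by rewrite Bs (linD (Bl _)) starD -!Bs.
have sym y : `|B x y + B y x| <= (`|x| + `|y|) ^+ 2 + (`|x| ^+ 2 + `|y| ^+ 2).
  have -> : B x y + B y x = B (x + y) (x + y) - (B x x + B y y).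
    rewrite BDl !(linD (Bl _)) [B y x + _]addrC [in RHS]addrACA.
    by rewrite [RHS]addrC addKr.
  rewrite (le_trans (ler_normB _ _))// lerD//.
    by rewrite n2 ler_pXn2r// ?nnegrE ?addr_ge0// ler_normD.
  by rewrite (le_trans (ler_normD _ _))// !n2.
pose C := (`|x| + 1) ^+ 2 + (`|x| ^+ 2 + 1 ^+ 2).
(* Only vectors of norm one are treated first, so that [C] does not depend on
   [y]. *)
have unit_bound y : `|y| = 1 -> `|B x y| <= C.
  move=> y1; rewrite -(ler_pM2l (ltr0n R[i] 2)) !mulr_natl -normrMn.
  have -> : B x y *+ 2 =
      (B x y + B y x) + (- 'i) *: (B x ('i *: y) + B ('i *: y) x).
    rewrite (Bs x ('i *: y)) (linZ (Bl x)) starZ -Bs conjCi scalerDr !scalerA.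
    rewrite mulrNN mulCii mulNr mulCii opprK scale1r scaleN1r.
    by rewrite addrACA subrr addr0 mulr2n.
  have iy : `|'i *: y| = 1 by rewrite normrZ normCi mul1r.
  rewrite (le_trans (ler_normD _ _))// mulr2n lerD//.
    by rewrite /C -y1.
  by rewrite normrZ normrN normCi mul1r /C -iy.
exists C => [|y]; first by rewrite !addr_ge0 ?exprn_ge0 ?addr_ge0.
have [->|y0] := eqVneq y 0.
  by rewrite (lin0 (Bl x)) !normr0 mulr0.
have ny : 0 < `|y| by rewrite normr_gt0.
rewrite -ler_pdivrMr// mulrC -[_^-1]gtr0_norm ?invr_gt0//.
rewrite -normrZ -(linZ (Bl x)).
by apply: unit_bound; rewrite normrZ gtr0_norm ?invr_gt0// mulVf// gt_eqF.
Qed.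

Section Bimodule.
Context {R : realType} {A : cstarAlgType R} {X : hilbertBimodType A}.
Implicit Types (x y : X) (a : A).

Lemma rinner_bounded x :
  exists2 C, 0 <= C & forall y, `|rinner x y : A| <= C * `|y|.
Proof.
exact: (inner_bounded (rinner_linear (s := X)) (rinner_star (s := X))
  (norm_rinner (s := X))).
Qed.

Lemma linner_bounded y :
  exists2 C, 0 <= C & forall x, `|linner x y : A| <= C * `|x|.
Proof.
apply: (@inner_bounded R A X (fun y x => linner x y)).
- exact: linner_linear.
- by move=> x z; exact: linner_star.
- exact: norm_linner.
Qed.

Lemma norm_ract x a : `|ract x a| <= `|x| * `|a|.
Proof.
rewrite -(@ler_pXn2r _ 2) ?nnegrE ?mulr_ge0//.
have n2 z : `|z| ^+ 2 = `|rinner z z : A| by rewrite norm_rinner sqrtCK.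
rewrite exprMn !n2 rinner_ract (rinner_star (s := X)) rinner_ract star_cmul.
rewrite -rinner_star.
rewrite -cmulA (le_trans (norm_cmul _ _))// norm_star mulrC expr2 mulrA.
by rewrite ler_wpM2r// norm_cmul.
Qed.

Lemma norm_lact a x : `|lact a x| <= `|a| * `|x|.
Proof.
rewrite -(@ler_pXn2r _ 2) ?nnegrE ?mulr_ge0//.
have n2 z : `|z| ^+ 2 = `|linner z z : A| by rewrite norm_linner sqrtCK.
rewrite exprMn !n2 linner_lact (linner_star (s := X)) linner_lact star_cmul.
rewrite -linner_star.
rewrite (le_trans (norm_cmul _ _))// expr2 -mulrA ler_wpM2l//.
by rewrite (le_trans (norm_cmul _ _))// norm_star mulrC.
Qed.

Lemma ractBr x a b : ract x (a - b) = ract x a - ract x b.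
Proof. exact: (linB (ract_linearr x)). Qed.
Lemma lactBl a b x : lact (a - b) x = lact a x - lact b x.
Proof. exact: (linB (lact_linearl x)). Qed.

Variable I : set A.
Hypothesis I_ideal : is_ideal I.

Lemma rinner_ideal x y : ideal_rmul X I y -> I (rinner x y).
Proof.
apply: closed_span_image.
- exact: rinner_linear.
- exact: rinner_bounded.
- exact: ideal_closed_submod.
- move=> _ [z _ [a Ia <-]]; rewrite rinner_ract.
  by have [_ _ _ Im] := I_ideal; have [] := Im (rinner x z) _ Ia.
Qed.

Lemma linner_ideal x y : ideal_lmul I X x -> I (linner x y).
Proof.
apply: (@closed_span_image _ X A (fun x => linner x y)).
- exact: linner_linear.
- exact: linner_bounded.
- exact: ideal_closed_submod.
- move=> _ [a Ia [z _ <-]]; rewrite linner_lact.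
  by have [_ _ _ Im] := I_ideal; have [] := Im (linner z y) _ Ia.
Qed.

Lemma ract_ideal x a : I a -> ideal_rmul X I (ract x a).
Proof. by move=> Ia; apply: sub_closed_span; exists x => //; exists a. Qed.

Lemma lact_ideal a x : I a -> ideal_lmul I X (lact a x).
Proof. by move=> Ia; apply: sub_closed_span; exists a => //; exists x. Qed.

(** Non-degeneracy of the right action of [I] on [X_I]: the generator [x a] is
    approximated by [(x a) c], where [c] in [I] is such that [a c] is close to
    [a]. *)
Lemma ideal_rmul_nondegenerate :
  ideal_rmul X I `<=`
  closed_span [set ract x a | x in ideal_rmul X I & a in I].
Proof.
apply: closed_span_min; first exact: closed_span_submod.
move=> _ [x _ [a Ia <-]]; have [cT _ _] := closed_span_submod
  [set ract x a | x in ideal_rmul X I & a in I].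
apply: closed_approx => // e e0.
have x0 : 0 < `|x| + 1 by rewrite ltr_wpDl.
have [c Ic ac] := ideal_right_unit I_ideal Ia (divr_gt0 e0 x0).
exists (ract x (cmul a c)).
  apply: sub_closed_span; exists (ract x a); first exact: ract_ideal.
  by exists c => //; rewrite ractA.
rewrite ltr_pdivlMr// in ac; apply: le_lt_trans ac.
rewrite -ractBr (le_trans (norm_ract _ _))// mulrC ler_wpM2l// lerDl.
by [].
Qed.

Lemma ideal_lmul_nondegenerate :
  ideal_lmul I X `<=`
  closed_span [set lact a x | a in I & x in ideal_lmul I X].
Proof.
apply: closed_span_min; first exact: closed_span_submod.
move=> _ [a Ia [x _ <-]]; have [cT _ _] := closed_span_submod
  [set lact a x | a in I & x in ideal_lmul I X].
apply: closed_approx => // e e0.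
have x0 : 0 < `|x| + 1 by rewrite ltr_wpDl.
have [c Ic ac] := ideal_left_unit I_ideal Ia (divr_gt0 e0 x0).
exists (lact (cmul c a) x).
  apply: sub_closed_span; exists c => //; exists (lact a x).
    exact: lact_ideal.
  by rewrite lactA.
rewrite ltr_pdivlMr// in ac; apply: le_lt_trans ac.
rewrite -lactBl (le_trans (norm_lact _ _))// ler_wpM2l// lerDl.
by [].
Qed.

End Bimodule.

(** * Closed subspaces as complete normed modules *)

(** A closed linear subspace, bundled with the proof that it is one, so that the
    structures on its carrier can be inferred. *)
Record closedSub (R : realType) (V : completeNormedModType R[i]) := ClosedSub {
  csub_set : set V;
  csubP : closed_submod csub_set
}.

(** The carrier of a closed subspace is convertible to the subtype given by the
    underlying set. *)
Definition csub_type (R : realType) (V : completeNormedModType R[i])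
  (N : closedSub V) := set_type (csub_set N).

Section ClosedSubmodule.
Context {R : realType} {V : completeNormedModType R[i]} (N : closedSub V).
Local Notation T := (csub_type N).

HB.instance Definition _ := Choice.on T.

Definition csub_val (x : T) : V := \val x.
Definition csub_sub (x : V) (Nx : csub_set N x) : T := exist _ x (mem_set Nx).

Lemma csub_val_inj : injective csub_val.
Proof. exact: val_inj. Qed.

Lemma csub_valP (x : T) : csub_set N (csub_val x).
Proof. exact: set_valP. Qed.

Lemma csub_lin (l : R[i]) x y :
  csub_set N x -> csub_set N y -> csub_set N (l *: x + y).
Proof. by have [_ _] := csubP N; apply. Qed.

Lemma csub_0 : csub_set N 0.
Proof. by have [] := csubP N. Qed.

Definition csub_comb (l : R[i]) (x y : T) : T :=
  csub_sub (csub_lin l (csub_valP x) (csub_valP y)).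

Let zero : T := csub_sub csub_0.
Let add (x y : T) : T := csub_comb 1 x y.
Let opp (x : T) : T := csub_comb (-1) x zero.
Let scale (l : R[i]) (x : T) : T := csub_comb l x zero.

Let val_add x y : csub_val (add x y) = csub_val x + csub_val y.
Proof. by rewrite /csub_val /= scale1r. Qed.
Let val_opp x : csub_val (opp x) = - csub_val x.
Proof. by rewrite /csub_val /= addr0 scaleN1r. Qed.
Let val_scale l x : csub_val (scale l x) = l *: csub_val x.
Proof. by rewrite /csub_val /= addr0. Qed.

Let addA : associative add.
Proof. by move=> x y z; apply: csub_val_inj; rewrite !val_add addrA. Qed.
Let addC : commutative add.
Proof. by move=> x y; apply: csub_val_inj; rewrite !val_add addrC. Qed.
Let add0 : left_id zero add.
Proof. by move=> x; apply: csub_val_inj; rewrite !val_add add0r. Qed.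
Let addN : left_inverse zero opp add.
Proof. by move=> x; apply: csub_val_inj; rewrite val_add val_opp addNr. Qed.

HB.instance Definition _ := GRing.isZmodule.Build T addA addC add0 addN.

Let scaleA a b v : scale a (scale b v) = scale (a * b) v.
Proof. by apply: csub_val_inj; rewrite !val_scale scalerA. Qed.
Let scale1 : left_id 1 scale.
Proof. by move=> v; apply: csub_val_inj; rewrite val_scale scale1r. Qed.
Let scaleDr : right_distributive scale +%R.
Proof.
by move=> a u v; apply: csub_val_inj; rewrite !(val_scale, val_add) scalerDr.
Qed.
Let scaleDl v : {morph scale^~ v: a b / a + b}.
Proof.
by move=> a b; apply: csub_val_inj; rewrite !(val_scale, val_add) scalerDl.
Qed.

HB.instance Definition _ :=
  GRing.Zmodule_isLmodule.Build R[i] T scaleA scale1 scaleDr scaleDl.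

Lemma csub_val_linear : linear csub_val.
Proof. by move=> l x y; rewrite [LHS]val_add val_scale. Qed.

Let nrm (x : T) : R[i] := `|csub_val x|.
Let nrmD x y : nrm (x + y) <= nrm x + nrm y.
Proof. by rewrite /nrm (linD csub_val_linear) ler_normD. Qed.
Let nrmZ (l : R[i]) x : nrm (l *: x) = `|l| * nrm x.
Proof. by rewrite /nrm (linZ csub_val_linear) normrZ. Qed.
Let nrm0 x : nrm x = 0 -> x = 0.
Proof.
move=> /normr0_eq0 x0; apply: csub_val_inj.
by rewrite x0 (lin0 csub_val_linear).
Qed.

HB.instance Definition _ := Lmodule_isNormed.Build R[i] T nrmD nrmZ nrm0.

Lemma csub_norm (x : T) : `|x| = `|csub_val x|.
Proof. by []. Qed.

Lemma csub_complete (F : set_system T) : ProperFilter F -> cauchy F -> cvg F.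
Proof.
move=> FF /cauchy_ballP FC.
have cG : cauchy (csub_val @ F).
  apply/cauchy_ballP => e e0; have [[B C] /= [FB FCC] BC] := FC e e0.
  exists (csub_val @` B, csub_val @` C) => /=.
    by split; [apply: filterS FB|apply: filterS FCC] => x Px; exists x.
  move=> [_ _] [/= [x Bx <-] [y Cy <-]]; have := BC (x, y) (conj Bx Cy).
  by rewrite -!ball_normE /= -(linB csub_val_linear) -csub_norm.
have /cvg_ex[l Gl] : cvg (csub_val @ F) by exact: cauchy_cvg.
have Nl : csub_set N l.
  have [cN _ _] := csubP N; apply: closed_cvg Gl => //.
  by apply: nearW => x; exact: csub_valP.
apply/cvg_ex; exists (csub_sub Nl); apply/cvgrPdist_lt => e e0.
move/cvgrPdist_lt/(_ e e0): Gl; apply: filterS => x.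
by rewrite csub_norm (linB csub_val_linear).
Qed.

HB.instance Definition _ := Uniform_isComplete.Build T csub_complete.

(** A closed span computed inside the subspace contains any element that lies
    in the closed span, in the ambient space, of the included generators. *)
Lemma csub_lift (W : set V) (M : set T) (x : T) :
  (forall v, W v -> exists2 y, M y & csub_val y = v) ->
  closed_span W (csub_val x) -> closed_span M x.
Proof.
move=> WM /closureP_norm Wx; apply/closureP_norm => e e0.
have [_ [n [c [s [Ws ->]]]] xs] := Wx e e0.
have /choice[t st] i : exists y, M y /\ csub_val y = s i.
  by have [y My ys] := WM _ (Ws i); exists y.
exists (\sum_(i < n) c i *: t i).
  by exists n, c, t; split => // i; have [] := st i.
rewrite csub_norm (linB csub_val_linear) (lin_sum csub_val_linear).
by rewrite (eq_bigr _ (fun i _ => congr1 _ (st i).2)).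
Qed.

End ClosedSubmodule.

(** * A closed ideal as a C*-algebra *)

(** The closed two-sided ideals of [A]. *)
Definition idealOf (R : realType) (A : cstarAlgType R) :=
  {I : set A | is_ideal I}.

Definition ideal_csub (R : realType) (A : cstarAlgType R) (J : idealOf A) :
    closedSub A :=
  ClosedSub (ideal_closed_submod (svalP J)).

(** The C*-algebra with underlying set the ideal [J]. *)
Definition ideal_type (R : realType) (A : cstarAlgType R) (J : idealOf A) :=
  csub_type (ideal_csub J).

Section IdealAlgebra.
Context {R : realType} {A : cstarAlgType R} (J : idealOf A).
Local Notation T := (ideal_type J).
HB.instance Definition _ := CompleteNormedModule.on T.

Let v : T -> A := @csub_val _ _ _.
Let vlin : linear v := @csub_val_linear _ _ _.

Lemma ideal_cmul_closed (a b : T) : sval J (cmul (v a) (v b)).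
Proof.
have [_ _ _ Jm] := svalP J.
by have [] := Jm (v a) (v b) (csub_valP b).
Qed.

Lemma ideal_star_closed (a : T) : sval J (star (v a)).
Proof. by apply: ideal_star (csub_valP a); exact: (svalP J). Qed.

Definition ideal_cmul (a b : T) : T :=
  csub_sub (N := ideal_csub J) (ideal_cmul_closed a b).
Definition ideal_starop (a : T) : T :=
  csub_sub (N := ideal_csub J) (ideal_star_closed a).

Let vmul a b : v (ideal_cmul a b) = cmul (v a) (v b). Proof. by []. Qed.
Let vstar a : v (ideal_starop a) = star (v a). Proof. by []. Qed.
Let vnorm a : `|a| = `|v a|. Proof. by []. Qed.
Let v_inj : injective v. Proof. exact: csub_val_inj. Qed.

Let mulA : associative ideal_cmul.
Proof. by move=> a b c; apply: v_inj; rewrite !vmul cmulA. Qed.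
Let mul_linl b : linear (fun a => ideal_cmul a b).
Proof. by move=> l a c; apply: v_inj; rewrite vlin !vmul vlin cmul_linearl. Qed.
Let mul_linr a : linear (fun b => ideal_cmul a b).
Proof. by move=> l b c; apply: v_inj; rewrite vlin !vmul vlin cmul_linearr. Qed.
Let star_lin (l : R[i]) a b :
  ideal_starop (l *: a + b) = Num.conj l *: ideal_starop a + ideal_starop b.
Proof. by apply: v_inj; rewrite vlin !vstar vlin star_conj_linear. Qed.
Let star_inv : involutive ideal_starop.
Proof. by move=> a; apply: v_inj; rewrite !vstar starK. Qed.
Let star_mul a b :
  ideal_starop (ideal_cmul a b) = ideal_cmul (ideal_starop b) (ideal_starop a).
Proof. by apply: v_inj; rewrite !(vstar, vmul) star_cmul. Qed.
Let norm_mul a b : `|ideal_cmul a b| <= `|a| * `|b|.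
Proof. by rewrite !vnorm vmul norm_cmul. Qed.
Let cstar_id a : `|ideal_cmul (ideal_starop a) a| = `|a| ^+ 2.
Proof. by rewrite !vnorm vmul vstar cstar_identity. Qed.

HB.instance Definition _ := isCStarAlgebra.Build R T
  mulA mul_linl mul_linr star_lin star_inv star_mul norm_mul cstar_id.

(** The inclusion of the ideal. *)
Definition ideal_val (a : T) : A := v a.

(** An inverse of [(a, - l)] in the unitization of [A] lies in the unitization
    of the ideal when [l <> 0]. The point [l = 0] is allowed in the spectrum of
    a positive element, so nothing has to be said about it. *)
Lemma positive_ideal (a : T) : positive (ideal_val a) -> positive a.
Proof.
move=> [sa spa]; split; first exact: v_inj.
move=> l Hl; have [->|l0] := eqVneq l 0; first exact: lexx.
apply: spa => -[[y1 y2] [Ey yE]]; apply: Hl.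
rewrite /unitization_mul /= in Ey yE.
case: Ey => Ey1 Ey2; case: yE => yE1 _.
have [_ J0 Jl Jm] := svalP J.
have Jy : sval J y1.
  have -> : y1 = l^-1 *: (cmul (ideal_val a) y1 + y2 *: ideal_val a).
    rewrite scaleNr in Ey1; move/eqP: Ey1; rewrite subr_eq0 => /eqP ->.
    by rewrite scalerA mulVf// scale1r.
  rewrite -[_ *: _]addr0; apply: (Jl) => //; rewrite addrC; apply: Jl.
    exact: csub_valP.
  by have [] := Jm y1 (ideal_val a) (csub_valP a).
exists (csub_sub (N := ideal_csub J) Jy : T, y2); rewrite /unitization_mul /=.
split; congr (_, _) => //.
- by apply: v_inj; rewrite !(linD vlin) !(linZ vlin) (lin0 vlin).
- by apply: v_inj; rewrite !(linD vlin) !(linZ vlin) (lin0 vlin).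
- by rewrite mulrC.
Qed.

End IdealAlgebra.

(** * The Hilbert bimodule of an invariant ideal *)

(** The closed subspace [X_J = X J]. *)
Definition ideal_bimod_csub (R : realType) (A : cstarAlgType R)
    (X : hilbertBimodType A) (J : idealOf A) : closedSub X :=
  @ClosedSub R X (ideal_rmul X (sval J)) (closed_span_submod _).

(** The carrier of [X_J]. The proof of invariance is a parameter of the type
    because the left action and the left inner product on [X_J] depend on it. *)
Definition ideal_bimod (R : realType) (A : cstarAlgType R)
    (X : hilbertBimodType A) (J : idealOf A) (_ : is_invariant X (sval J)) :=
  csub_type (ideal_bimod_csub X J).

Section IdealBimodule.
Context {R : realType} {A : cstarAlgType R} {X : hilbertBimodType A}.
Context {J : idealOf A} (inv : is_invariant X (sval J)).
Local Notation B := (ideal_type J).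
Local Notation T := (ideal_bimod inv).

HB.instance Definition _ := CompleteNormedModule.on T.

Let v : T -> X := @csub_val _ _ _.
Let vlin : linear v := @csub_val_linear _ _ _.
Let w : B -> A := @ideal_val _ _ _.
Let wlin : linear w := @csub_val_linear _ _ _.
Let v_inj : injective v. Proof. exact: csub_val_inj. Qed.
Let w_inj : injective w. Proof. exact: csub_val_inj. Qed.
Let wP (a : B) : sval J (w a).
Proof. exact: (csub_valP (N := ideal_csub J)). Qed.
Let vP (x : T) : ideal_rmul X (sval J) (v x).
Proof. exact: (csub_valP (N := ideal_bimod_csub X J)). Qed.
Let vPl (x : T) : ideal_lmul (sval J) X (v x).
Proof. rewrite inv; exact: vP. Qed.

Lemma lact_ideal_rmul (a : A) (x : X) :
  sval J a -> ideal_rmul X (sval J) (lact a x).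
Proof. by move=> Ja; rewrite -inv; exact: lact_ideal. Qed.

Let ra (x : T) (a : B) : T :=
  csub_sub (N := ideal_bimod_csub X J) (ract_ideal (x := v x) (wP a)).
Let la (a : B) (x : T) : T :=
  csub_sub (N := ideal_bimod_csub X J) (lact_ideal_rmul (x := v x) (wP a)).
Let ri (x y : T) : B :=
  csub_sub (N := ideal_csub J) (rinner_ideal (svalP J) (v x) (vP (x := y))).
Let li (x y : T) : B :=
  csub_sub (N := ideal_csub J) (linner_ideal (svalP J) (v y) (vPl (x := x))).

Let vra x a : v (ra x a) = ract (v x) (w a). Proof. by []. Qed.
Let vla a x : v (la a x) = lact (w a) (v x). Proof. by []. Qed.
Let wri x y : w (ri x y) = rinner (v x) (v y). Proof. by []. Qed.
Let wli x y : w (li x y) = linner (v x) (v y). Proof. by []. Qed.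
Let wmul a b : w (cmul a b) = cmul (w a) (w b). Proof. by []. Qed.
Let wstar a : w (star a) = star (w a). Proof. by []. Qed.
Let vnorm (x : T) : `|x| = `|v x|. Proof. by []. Qed.
Let wnorm (a : B) : `|a| = `|w a|. Proof. by []. Qed.

Let ra_linl a : linear (fun x => ra x a).
Proof. by move=> l x y; apply: v_inj; rewrite vlin !vra vlin ract_linearl. Qed.
Let ra_linr x : linear (fun a => ra x a).
Proof. by move=> l a b; apply: v_inj; rewrite vlin !vra wlin ract_linearr. Qed.
Let raA x a b : ra (ra x a) b = ra x (cmul a b).
Proof. by apply: v_inj; rewrite !vra wmul ractA. Qed.
Let ra_nd : closed_span [set ra x a | x in [set: T] & a in [set: B]] = [set: T].
Proof.
apply/seteqP; split=> // x _.
apply: (csub_lift (N := ideal_bimod_csub X J))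
  (ideal_rmul_nondegenerate (svalP J) (vP (x := x))).
move=> _ [y Xy [a Ja <-]].
pose y' : T := csub_sub (N := ideal_bimod_csub X J) Xy.
pose a' : B := csub_sub (N := ideal_csub J) Ja.
by exists (ra y' a') => //; exists y' => //; exists a'.
Qed.
Let ri_lin x : linear (fun y => ri x y).
Proof. by move=> l y z; apply: w_inj; rewrite wlin !wri vlin rinner_linear. Qed.
Let ri_ra x y a : ri x (ra y a) = cmul (ri x y) a.
Proof. by apply: w_inj; rewrite wmul !wri vra rinner_ract. Qed.
Let ri_star x y : ri y x = star (ri x y).
Proof. by apply: w_inj; rewrite wstar !wri -rinner_star. Qed.
Let ri_ge0 x : positive (ri x x).
Proof. exact/positive_ideal/rinner_ge0. Qed.
Let norm_ri x : `|x| = sqrtC `|ri x x|.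
Proof. by rewrite vnorm wnorm wri norm_rinner. Qed.

Let la_linl x : linear (fun a => la a x).
Proof. by move=> l a b; apply: v_inj; rewrite vlin !vla wlin lact_linearl. Qed.
Let la_linr a : linear (fun x => la a x).
Proof. by move=> l x y; apply: v_inj; rewrite vlin !vla vlin lact_linearr. Qed.
Let laA a b x : la a (la b x) = la (cmul a b) x.
Proof. by apply: v_inj; rewrite !vla wmul lactA. Qed.
Let la_nd : closed_span [set la a x | a in [set: B] & x in [set: T]] = [set: T].
Proof.
apply/seteqP; split=> // x _.
apply: (csub_lift (N := ideal_bimod_csub X J))
  (ideal_lmul_nondegenerate (svalP J) (vPl (x := x))).
move=> _ [a Ja [y Xl <-]]; have Xy : ideal_rmul X (sval J) y by rewrite -inv.
pose y' : T := csub_sub (N := ideal_bimod_csub X J) Xy.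
pose a' : B := csub_sub (N := ideal_csub J) Ja.
by exists (la a' y') => //; exists a' => //; exists y'.
Qed.
Let li_lin y : linear (fun x => li x y).
Proof. by move=> l x z; apply: w_inj; rewrite wlin !wli vlin linner_linear. Qed.
Let li_la a x y : li (la a x) y = cmul a (li x y).
Proof. by apply: w_inj; rewrite wmul !wli vla linner_lact. Qed.
Let li_star x y : li y x = star (li x y).
Proof. by apply: w_inj; rewrite wstar !wli -linner_star. Qed.
Let li_ge0 x : positive (li x x).
Proof. exact/positive_ideal/linner_ge0. Qed.
Let norm_li x : `|x| = sqrtC `|li x x|.
Proof. by rewrite vnorm wnorm wli norm_linner. Qed.
Let compat x y z : la (li x y) z = ra x (ri y z).
Proof. by apply: v_inj; rewrite vla vra wli wri inner_compat. Qed.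

HB.instance Definition _ := isLeftHilbertModule.Build R B T
  la_linl la_linr laA la_nd li_lin li_la li_star li_ge0 norm_li.
HB.instance Definition _ := isRightHilbertModule.Build R B T
  ra_linl ra_linr raA ra_nd ri_lin ri_ra ri_star ri_ge0 norm_ri.
HB.instance Definition _ := Left_Right_isHilbertBimodule.Build R B T compat.

(** The inclusion of [X_J] into [X]. *)
Definition ideal_bimod_val (x : T) : X := v x.

Lemma ideal_bimod_val_morphism :
  is_bimod_morphism ideal_bimod_val (@ideal_val R A J).
Proof. by split=> //; split. Qed.

Lemma range_ideal_val : range (@ideal_val R A J) = sval J.
Proof.
apply/seteqP; split=> [_ [a _ <-]|a Ja]; first exact: wP.
by exists (csub_sub (N := ideal_csub J) Ja).
Qed.

Lemma ideal_bimod_extension :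
  is_extension ideal_bimod_val (@ideal_val R A J).
Proof.
split; first exact: ideal_bimod_val_morphism; first exact: w_inj.
  by rewrite range_ideal_val; exact: svalP.
by rewrite range_ideal_val.
Qed.

End IdealBimodule.

(** * The proposition *)

Theorem proposition3p2 (R : realType) (A : cstarAlgType R)
    (X : hilbertBimodType A) (I : set A)
    (I_ideal : is_ideal I) (I_invariant : is_invariant X I) :
  exists (sI : cstar_on R (set_type I)),
  let IA : cstarAlgType R := cstar_of sI in
  let iA : IA -> A := fun a : set_type I => val a in
  exists (sX : hilbert_bimod_on IA (set_type (ideal_rmul X I))),
  let XI : hilbertBimodType IA := hilbert_bimod_of sX in
  let iX : XI -> X := fun x : set_type (ideal_rmul X I) => val x in
  [/\ (forall a : IA, `|a| = `|iA a|) /\ (forall x : XI, `|x| = `|iX x|),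
      is_bimod_morphism iX iA,
      is_extension iX iA
    & is_essential_extension iX iA <-> is_essential I].
Proof.
pose J : idealOf A := exist _ I I_ideal.
exists (CStarAlgebra.class (ideal_type J : cstarAlgType R)) => IA iA.
exists (HilbertBimodule.class
    (ideal_bimod (J := J) I_invariant : hilbertBimodType (ideal_type J)))
  => XI iX.
have ext : is_extension iX iA := ideal_bimod_extension (J := J) I_invariant.
split=> //; first exact: (ideal_bimod_val_morphism (J := J) I_invariant).
rewrite /is_essential_extension.
have -> : range iA = I := range_ideal_val (J := J).
by split=> [[]|].
Qed.
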